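(* Let $P$ be a $\mu$-reversible Markov kernel on $(E,\mathscr{E})$ with weak conductance $\kappa$, and let $\Phi=\|\cdot\|_{\mathrm{osc}}^2$. (1) If $\kappa(u)>0$ for all $u\in(0,1/4)$, then a $(\Phi,\alpha)$-WPI holds for $P$ with $$\alpha(r):=\frac{16}{\kappa^2(r/16)},\qquad r>0 .$$ (2) Conversely, if a $(\|\cdot\|_{\mathrm{osc}}^2,\alpha)$-WPI holds for $P$ for some $\alpha:(0,\infty)\to[0,\infty)$, then $$\frac{1}{\alpha(r)}\le\inf_{u>1}\left\{\kappa(ur)\frac{u}{u-1}\right\}\le 2\kappa(2r),\qquad r>0 .$$
   Context: $(E,\mathscr{E})$ is a measurable space with measurable diagonal, $\mu$ a probability measure on it. $L^2_0(\mu)$ is the set of real $f\in L^2(\mu)$ with $\mu(f)=0$; $\|f\|_{\mathrm{osc}}=\mathrm{ess}_\mu\sup f-\mathrm{ess}_\mu\inf f\in[0,\infty]$; $\mathcal{E}(P,f)=\langle(\mathrm{Id}-P)f,f\rangle$ in $L^2(\mu)$; $\mu\otimes P(A\times B)=\int_A\mu(\mathrm{d}x)P(x,B)$. $(\|\cdot\|_{\mathrm{osc}}^2,\alpha)$-WPI for $P$: $\alpha:(0,\infty)\to[0,\infty)$ is decreasing (non-increasing) and $$\|f\|_2^2\le\alpha(r)\,\mathcal{E}(P,f)+r\|f\|_{\mathrm{osc}}^2,\qquad\forall r>0,\ f\in L^2_0(\mu).$$ Weak conductance: $\kappa:[0,\infty)\to[0,\infty]$, $$\kappa(u)=\inf\left\{\frac{\mu\otimes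 P(A\times A^{\complement})}{\mu\otimes\mu(A\times A^{\complement})}:A\in\mathscr{E},\ \mu\otimes\mu(A\times A^{\complement})>u\right\},$$ with $\inf\emptyset=\infty$ (so $\kappa(u)=\infty$ for $u\ge1/4$). Conventions: $16/\infty=0$, $1/0=\infty$. *)

(* Defs.v *)
From HB Require Import structures.
From mathcomp Require Import all_boot all_order all_algebra.
From mathcomp Require Import all_classical all_reals all_analysis.
From mathcomp Require Import ess_sup_inf.

Set Implicit Arguments.
Unset Strict Implicit.
Unset Printing Implicit Defensive.

Import Order.TTheory GRing.Theory Num.Theory.
Import numFieldNormedType.Exports.

Local Open Scope classical_set_scope.
Local Open Scope ring_scope.
Local Open Scope ereal_scope.

Section weak_poincare.
Context d (E : measurableType d) (R : realType).
Variables (mu : probability E R) (P : R.-pker E ~> E).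

(* The value of the measure mu (x) P on the rectangle A x B. *)
Definition kprod_rect (A B : set E) : \bar R := \int[mu]_(x in A) P x B.

Definition reversible : Prop :=
  forall A B : set E, measurable A -> measurable B ->
    kprod_rect A B = kprod_rect B A.

Definition kernel_act (f : E -> R) (x : E) : R := (\int[P x]_y f y)%R.

Definition inner_L2 (f g : E -> R) : R := (\int[mu]_x (f x * g x))%R.

(* Off a mu-null set, f in L^2(mu) is P x-integrable (P being mu-invariant),
   so the default value of the real integral in kernel_act is harmless. *)
Definition dirichlet (f : E -> R) : R :=
  inner_L2 (fun x => f x - kernel_act f x)%R f.

Definition L2_0 : set (E -> R) :=
  [set f | f \in Lfun mu 2%:E /\ (\int[mu]_x f x)%R = 0%R].

Definition osc (f : E -> R) : \bar R :=
  ess_sup mu (EFin \o f) - ess_inf mu (EFin \o f).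

(* alpha : (0, oo) -> [0, oo) is represented by an extended-real function
   required to be finite and nonnegative on (0, oo), so that 16 / kappa^2 and
   1 / alpha are computed in [0, oo], where 1 / oo = 0 and 1 / 0 = oo. *)
Definition WPI (Phi : (E -> R) -> \bar R) (alpha : R -> \bar R) : Prop :=
  [/\ forall r : R, (0 < r)%R -> 0 <= alpha r < +oo,
      forall r s : R, (0 < r)%R -> (r <= s)%R -> alpha s <= alpha r
    & forall (r : R) (f : E -> R), (0 < r)%R -> L2_0 f ->
        'N[mu]_2%:E [EFin \o f] ^+ 2
          <= alpha r * (dirichlet f)%:E + r%:E * Phi f].

Definition weak_conductance (u : R) : \bar R :=
  ereal_inf [set kprod_rect A (~` A) / (mu \x mu) (A `*` ~` A) |
    A in [set A : set E | measurable A /\ u%:E < (mu \x mu) (A `*` ~` A)]].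

End weak_poincare.

(* Main.v *)
(** (1) is a Cheeger argument without medians. Let 0 < k <= kappa(u). Slicing
    a bounded function phi into its superlevel sets A and using
    k (mu (x) mu)(A x A^c) <= (mu (x) P)(A x A^c) + k u on each of them gives
      k E_{mu (x) mu}|phi(x) - phi(y)|
        <= E_{mu (x) P}|phi(x) - phi(y)| + 2 k u osc(phi).
    This is applied to phi = f |f| with mu(f) = 0, which satisfies pointwise
      |phi(x) - phi(y)| >= (f(x) - f(y))^2 / 2,
      |phi(x) - phi(y)| <= (2/k) (f(x) - f(y))^2 + (k/4) (f(x)^2 + f(y)^2).
    The lower bound has (mu (x) mu)-integral ||f||^2 and the upper bound has
    (mu (x) P)-integral (4/k) E(P, f) + (k/2) ||f||^2, so that
      ||f||^2 <= (8/k^2) E(P, f) + 4 u osc(f)^2.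
    The slack between (8, 4) and the required (16, 16) lets the slicing use a
    finite number of levels instead of an integral over all of them.

    (2) tests the inequality on f = mu(A) - 1_A, for which ||f||^2 is
    (mu (x) mu)(A x A^c), E(P, f) is (mu (x) P)(A x A^c) and osc(f) <= 1. *)

Require Import Defs.
From HB Require Import structures.
From mathcomp Require Import all_boot all_order all_algebra.
From mathcomp Require Import all_classical all_reals all_analysis.
From mathcomp Require Import measurable_realfun ess_sup_inf ring lra.

Import Order.TTheory GRing.Theory Num.Theory.
Import numFieldNormedType.Exports.

Set Implicit Arguments.
Unset Strict Implicit.
Unset Printing Implicit Defensive.

Local Open Scope classical_set_scope.
Local Open Scope ring_scope.
Local Open Scope ereal_scope.

(** * Probability kernels and invariance of a reversible measure *)

Lemma integral_cst_prob d (T : measurableType d) (R : realType)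
    (m : {measure set T -> \bar R}) (c : \bar R) :
  m setT = 1 -> \int[m]_x c = c.
Proof.
move=> m1; transitivity (\int[m]_x (cst c x)) => //.
by rewrite integral_cst// m1 mule1.
Qed.

Section constant_kernel.
Context d (E : measurableType d) (R : realType) (mu : probability E R).

(** The kernel whose next point is independent of the current one. It is reversible, so each fact
    about a reversible kernel [K] has its counterpart for mu (x) mu at [K := cst_kernel mu]. *)
Definition cst_kernel : R.-pker E ~> E :=
  kprobability (measurable_cst (mu : pprobability E R)).

Lemma int_cst_kernel x f : \int[cst_kernel x]_y f y = \int[mu]_y f y.
Proof. by []. Qed.
End constant_kernel.

Section invariance.
Context d (E : measurableType d) (R : realType) (mu : probability E R).
Variable K : R.-pker E ~> E.

(* The ignored first coordinate is there to match the parameter in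
   [integral_kcomp]. *)
Definition snd_kernel (xy : E * E) : {measure set E -> \bar R} := K xy.2.

Let measurable_snd_kernel U : measurable U ->
  measurable_fun [set: E * E] (snd_kernel ^~ U).
Proof.
by move=> mU; exact: (measurableT_comp (measurable_kernel K _ mU) measurable_snd).
Qed.

HB.instance Definition _ := isKernel.Build _ _ _ _ _ snd_kernel measurable_snd_kernel.

Let snd_kernelT xy : snd_kernel xy setT = 1.
Proof. exact: prob_kernel. Qed.

HB.instance Definition _ := Kernel_isProbability.Build _ _ _ _ _ snd_kernel snd_kernelT.

Hypothesis revK : reversible mu K.

(** Composing the constant kernel mu with [K] gives the measure A |-> (mu (x) K)(E x A). By
    reversibility this is (mu (x) K)(A x E) = mu(A), and equal measures have equal integrals. *)
Lemma invariant_integral (f : E -> \bar R) : (forall x, 0 <= f x) ->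
  measurable_fun setT f -> \int[mu]_x \int[K x]_y f y = \int[mu]_x f x.
Proof.
move=> f0 mf.
(* A composed kernel is evaluated at a starting point, so one has to be picked; without any point
   both sides are integrals over the empty set. *)
have [[x _]|noE] := pselect (exists x : E, True); last first.
  have E0 : @setT E = set0 by rewrite -subset0 => x _; apply: noE; exists x.
  by rewrite E0 !integral_set0.
rewrite -(@integral_kcomp _ _ _ _ _ _ R (cst_kernel mu) snd_kernel x) //.
apply: eq_measure_integral => A mA _.
rewrite /= /kcomp int_cst_kernel /snd_kernel /=.
have := revK (@measurableT _ E) mA.
rewrite /kprod_rect => ->.
under eq_integral do rewrite prob_kernel.
by rewrite integral_cst// mul1e.
Qed.
End invariance.

(** * Integrals over pairs of successive points *)

Section edge_integral.
Context d (E : measurableType d) (R : realType) (mu : probability E R).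
Variable K : R.-pker E ~> E.

(* The integral of F against mu (x) K; with K = cst_kernel mu it is the one
   against mu (x) mu. *)
Definition edge_integral (F : E * E -> R) : \bar R :=
  \int[mu]_x \int[K x]_y (F (x, y))%:E.

Section nonneg.
Variable F : E * E -> R.
Hypotheses (mF : measurable_fun setT F) (F0 : forall z, (0 <= F z)%R).

Lemma measurable_edge_section x : measurable_fun setT (fun y => (F (x, y))%:E).
Proof. by apply/measurable_EFinP; exact: measurableT_comp. Qed.

Lemma measurable_kernel_integral :
  measurable_fun setT (fun x => \int[K x]_y (F (x, y))%:E).
Proof.
apply: (measurable_fun_integral_finite_kernel (fun z => (F z)%:E) K) => //.
exact/measurable_EFinP.
Qed.

Lemma edge_integral_ge0 : 0 <= edge_integral F.
Proof.
by apply: integral_ge0 => x _; apply: integral_ge0 => y _; rewrite lee_fin.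
Qed.
End nonneg.

Implicit Types (F G : E * E -> R) (g : E -> R) (A B : set E).

Lemma le_edge_integral F G :
  measurable_fun setT F -> (forall z, (0 <= F z)%R) ->
  measurable_fun setT G -> (forall z, (F z <= G z)%R) ->
  edge_integral F <= edge_integral G.
Proof.
move=> mF F0 mG FG.
have G0 z : (0 <= G z)%R by exact: le_trans (FG z).
apply: ge0_le_integral => //.
- by move=> x _; apply: integral_ge0 => y _; rewrite lee_fin.
- exact: measurable_kernel_integral.
- exact: measurable_kernel_integral.
- move=> x _; apply: ge0_le_integral => //.
  + by move=> y _; rewrite lee_fin.
  + exact: measurable_edge_section.
  + exact: measurable_edge_section.
  + by move=> y _; rewrite lee_fin.
Qed.

Lemma edge_integralD F G :
  measurable_fun setT F -> (forall z, (0 <= F z)%R) ->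
  measurable_fun setT G -> (forall z, (0 <= G z)%R) ->
  edge_integral (F \+ G)%R = edge_integral F + edge_integral G.
Proof.
move=> mF F0 mG G0; rewrite /edge_integral -ge0_integralD//.
- apply: eq_integral => x _; rewrite -ge0_integralD//.
  + by move=> y _; rewrite lee_fin.
  + exact: measurable_edge_section.
  + by move=> y _; rewrite lee_fin.
  + exact: measurable_edge_section.
- by move=> x _; apply: integral_ge0 => y _; rewrite lee_fin.
- exact: measurable_kernel_integral.
- by move=> x _; apply: integral_ge0 => y _; rewrite lee_fin.
- exact: measurable_kernel_integral.
Qed.

Lemma edge_integralZl (c : R) F : (0 <= c)%R ->
  measurable_fun setT F -> (forall z, (0 <= F z)%R) ->
  edge_integral (fun z => c * F z)%R = c%:E * edge_integral F.
Proof.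
move=> c0 mF F0; rewrite /edge_integral -ge0_integralZl//.
- apply: eq_integral => x _; rewrite -ge0_integralZl//.
  + exact: measurable_edge_section.
  + by move=> y _; rewrite lee_fin.
- exact: measurable_kernel_integral.
- by move=> x _; apply: integral_ge0 => y _; rewrite lee_fin.
Qed.

Lemma edge_integral_sum n (F : nat -> E * E -> R) :
  (forall i, measurable_fun setT (F i)) -> (forall i z, (0 <= F i z)%R) ->
  edge_integral (fun z => \sum_(i < n) F i z)%R =
  \sum_(i < n) edge_integral (F i).
Proof.
move=> mF F0; elim: n => [|n IHn].
  rewrite big_ord0 /edge_integral; apply: integral0_eq => x _.
  by apply: integral0_eq => y _; rewrite big_ord0.
rewrite big_ord_recr/= -IHn -edge_integralD//.
- by congr edge_integral; apply/funext => z; rewrite big_ord_recr.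
- exact: measurable_sum.
- by move=> z; exact: sumr_ge0.
Qed.

Lemma edge_integral_cst (c : R) : edge_integral (cst c) = c%:E.
Proof.
rewrite -[RHS](integral_cst_prob _ (probability_setT mu)).
by apply: eq_integral => x _ /=; apply: integral_cst_prob; exact: prob_kernel.
Qed.

Lemma edge_integral_fst (g : E -> R) :
  edge_integral (g \o fst) = \int[mu]_x (g x)%:E.
Proof.
by apply: eq_integral => x _ /=; apply: integral_cst_prob; exact: prob_kernel.
Qed.

Lemma edge_integral_snd (g : E -> R) : reversible mu K ->
  measurable_fun setT g -> (forall x, (0 <= g x)%R) ->
  edge_integral (g \o snd) = \int[mu]_x (g x)%:E.
Proof.
move=> revK mg g0; rewrite -(invariant_integral revK)//.
exact/measurable_EFinP.
Qed.

Lemma edge_integral_indic (A B : set E) : measurable A -> measurable B ->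
  edge_integral (fun z => \1_A z.1 * \1_B z.2)%R = kprod_rect mu K A B.
Proof.
move=> mA mB; rewrite /kprod_rect integral_mkcond.
apply: eq_integral => x _; rewrite patchE /=.
under eq_integral do rewrite EFinM.
rewrite ge0_integralZl//; last exact/measurable_EFinP.
rewrite integral_indic// setIT indicE.
by case: ifPn => _; rewrite ?mul1e ?mul0e.
Qed.

(** |1_A(x) - 1_A(y)| = 1_A(x) 1_{A^c}(y) + 1_{A^c}(x) 1_A(y), and reversibility gives both terms
    the same integral. *)
Lemma edge_integral_cut (A : set E) : measurable A -> reversible mu K ->
  edge_integral (fun z => `|\1_A z.1 - \1_A z.2|)%R =
  2%:E * kprod_rect mu K A (~` A).
Proof.
move=> mA revK.
have mAC : measurable (~` A) by exact: measurableC.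
have mul2 (x : \bar R) : 2%:E * x = x + x.
  by rewrite -[2%R]/(1 + 1)%R EFinD ge0_muleDl// mul1e.
rewrite mul2 {2}revK// -!edge_integral_indic// -edge_integralD//.
- congr edge_integral; apply/funext => -[x y] /=.
  rewrite indicC /= !indicE.
  by do 2 case: (_ \in _); rewrite /= ?(subrr, subr0, sub0r, normrN, normr0,
    normr1, mulr0, mulr1, mul0r, addr0, add0r).
- apply: measurable_funM; apply: measurableT_comp => //; exact: measurable_indic.
- apply: measurable_funM; apply: measurableT_comp => //; exact: measurable_indic.
Qed.
End edge_integral.

Section constant_kernel_cut.
Context d (E : measurableType d) (R : realType) (mu : probability E R).

Lemma kprod_rect_cst (A B : set E) : measurable A ->
  kprod_rect mu (cst_kernel mu) A B = mu A * mu B.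
Proof. by move=> mA; rewrite /kprod_rect integral_cst// muleC. Qed.

Lemma reversible_cst : reversible mu (cst_kernel mu).
Proof. by move=> A B mA mB; rewrite !kprod_rect_cst// muleC. Qed.
End constant_kernel_cut.

(** * Slicing into finitely many levels, and the weak L^1 inequality *)

Section levels.
Variable R : realDomainType.
Implicit Types a b n : nat.

Lemma sum_ltn_nat a n : (a <= n)%N -> (\sum_(i < n) (i < a)%N%:R = a%:R :> R)%R.
Proof.
move=> an; rewrite -natr_sum; congr (_%:R)%R.
rewrite -(subnKC an) big_split_ord/= [X in (_ + X)%N]big1 ?addn0; last first.
  by move=> i _; rewrite ltnNge leq_addr.
rewrite (eq_bigr (fun=> 1%N)); first by rewrite sum1_card card_ord.
by move=> i _; rewrite ltn_ord.
Qed.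

(** The differences of indicators all have the sign of a - b, so the absolute values can be taken
    outside the sum. This is the discrete coarea formula on the line. *)
Lemma sum_normB_levels a b n : (a <= n)%N -> (b <= n)%N ->
  (\sum_(i < n) `|(i < a)%N%:R - (i < b)%N%:R| = `|a%:R - b%:R| :> R)%R.
Proof.
wlog ab : a b / (a <= b)%N => [H an bn|an bn].
  have [ab|/ltnW ba] := leqP a b; first exact: H.
  by rewrite distrC -(H b a)//; apply: eq_bigr => i _; rewrite distrC.
rewrite distrC ger0_norm ?subr_ge0 ?ler_nat//.
rewrite -{1}(sum_ltn_nat an) -(sum_ltn_nat bn) -sumrB; apply: eq_bigr => i _.
rewrite distrC ger0_norm// subr_ge0 ler_nat.
by case: ltnP => // /leq_trans/(_ ab) ->.
Qed.
End levels.

Section weak_L1_poincare.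
Context d (E : measurableType d) (R : realType) (mu : probability E R).
Variable P : R.-pker E ~> E.
Hypothesis revP : reversible mu P.
Variables (k u : R).
Hypotheses (k0 : (0 <= k)%R) (u0 : (0 <= u)%R).
Hypothesis cutP : forall A, measurable A ->
  k%:E * (mu A * mu (~` A)) <= kprod_rect mu P A (~` A) + (k * u)%:E.

(** Rounded down to a multiple of h, phi is h times the number of superlevel sets containing the
    point, and the cut inequality applies to each of these n sets. Each costs 2 h k u, in total 2 k
    u (h n). Rounding costs h with weight k under mu (x) mu and h once more under mu (x) P, hence (k
    + 1) h. *)
Lemma weak_L1_poincare (phi : E -> R) (h : R) (n : nat) :
  measurable_fun setT phi -> (0 < h)%R ->
  (forall x, 0 <= phi x <= h * n%:R)%R ->
  k%:E * edge_integral mu (cst_kernel mu) (fun z => `|phi z.1 - phi z.2|)%R <=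
  edge_integral mu P (fun z => `|phi z.1 - phi z.2|)%R +
  (2 * k * u * (h * n%:R) + (k + 1) * h)%:E.
Proof.
move=> mphi h0 phin.
pose N x := Num.truncn (phi x / h)%R.
(* With the threshold at i + 1, x lies in [A i] exactly when i < [N x], so [N x] counts the levels
   reached by x. *)
pose A i := [set x | (h * i.+1%:R <= phi x)%R].
have mA i : measurable (A i).
  rewrite -[A i]setTI.
  have -> : A i = phi @^-1` `[(h * i.+1%:R)%R, +oo[%classic.
    by apply/seteqP; split=> x /=; rewrite in_itv/= andbT.
  exact: mphi.
have AE i x : \1_(A i) x = (i < N x)%N%:R :> R.
  by rewrite indicE truncn_gt_nat ler_pdivlMr// mulrC mem_setE.
have Nn x : (N x <= n)%N.
  have /andP[p0 pn] := phin x.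
  rewrite -(ler_nat R); apply: (@le_trans _ _ (phi x / h)%R).
    by rewrite truncn_le divr_ge0// ltW.
  by rewrite ler_pdivrMr// mulrC.
pose F i (z : E * E) : R := `|\1_(A i) z.1 - \1_(A i) z.2|%R.
pose G (z : E * E) : R := (\sum_(i < n) F i z)%R.
have mF i : measurable_fun setT (F i).
  apply: measurableT_comp => //.
  by apply: measurable_funB; apply: measurableT_comp => //; exact: measurable_indic.
have mG : measurable_fun setT G by apply: measurable_sum.
have F0 i z : (0 <= F i z)%R by exact: normr_ge0.
have G0 z : (0 <= G z)%R by apply: sumr_ge0.
have GE z : G z = `|(N z.1)%:R - (N z.2)%:R|%R.
  rewrite -(sum_normB_levels _ (Nn z.1) (Nn z.2)).
  by apply: eq_bigr => i _; rewrite /F !AE.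
pose D (z : E * E) := `|phi z.1 - phi z.2|%R.
have mD : measurable_fun setT D.
  apply: measurableT_comp => //.
  by apply: measurable_funB; apply: measurableT_comp.
have D0 z : (0 <= D z)%R by exact: normr_ge0.
have DN x : (h * (N x)%:R <= phi x < h * (N x)%:R + h)%R.
  have /andP[p0 pn] := phin x.
  have /truncn_itv/andP[] : (0 <= phi x / h)%R by rewrite divr_ge0// ltW.
  rewrite ler_pdivlMr// ltr_pdivrMr// => h1 h2.
  by rewrite mulrC h1/= (lt_le_trans h2)// -natr1 mulrDl mul1r mulrC.
(* Each rounding error lies in [0, h), so a difference of two values moves by less than h in either
   direction. *)
have DG z : (D z <= h * G z + h)%R.
  rewrite GE /D -{1}(gtr0_norm h0) -normrM mulrBr ler_norml.
  have := ler_norm (h * (N z.1)%:R - h * (N z.2)%:R)%R.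
  have := ler_norm (- (h * (N z.1)%:R - h * (N z.2)%:R))%R; rewrite normrN.
  have /andP[] := DN z.1; have /andP[] := DN z.2; lra.
have GD z : (h * G z <= D z + h)%R.
  rewrite GE /D -{1}(gtr0_norm h0) -normrM mulrBr ler_norml.
  have := ler_norm (phi z.1 - phi z.2)%R.
  have := ler_norm (- (phi z.1 - phi z.2))%R; rewrite normrN.
  have /andP[] := DN z.1; have /andP[] := DN z.2; lra.
have mhG : measurable_fun setT (fun z => h * G z)%R by exact: measurable_funM.
have hG0 z : (0 <= h * G z)%R by rewrite mulr_ge0// ltW.
have edgeG (K : R.-pker E ~> E) : reversible mu K ->
    edge_integral mu K (fun z => h * G z)%R =
    \sum_(i < n) (2 * h)%:E * kprod_rect mu K (A i) (~` A i).
  move=> revK; rewrite edge_integralZl//; last exact: ltW.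
  rewrite edge_integral_sum// ge0_sume_distrr; last first.
    by move=> i _; exact: edge_integral_ge0.
  by apply: eq_bigr => i _; rewrite edge_integral_cut// muleA -EFinM mulrC.
have le1 : edge_integral mu (cst_kernel mu) D <=
    edge_integral mu (cst_kernel mu) (fun z => h * G z)%R + h%:E.
  rewrite -[X in _ <= _ + X](edge_integral_cst mu (cst_kernel mu)) -edge_integralD//.
    by apply: le_edge_integral => //; apply: measurable_funD.
  by move=> z; exact: ltW.
have le2 : edge_integral mu P (fun z => h * G z)%R <= edge_integral mu P D + h%:E.
  rewrite -[X in _ <= _ + X](edge_integral_cst mu P) -edge_integralD//.
    by apply: le_edge_integral => //; apply: measurable_funD.
  by move=> z; exact: ltW.
apply: (le_trans (lee_wpmul2l _ le1)); first by rewrite lee_fin.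
rewrite ge0_muleDr ?lee_fin ?(ltW h0)//; last exact: edge_integral_ge0.
rewrite edgeG; last exact: reversible_cst.
rewrite ge0_sume_distrr; last first.
  move=> i _; rewrite mule_ge0// ?lee_fin ?mulr_ge0 ?(ltW h0)//.
  by rewrite kprod_rect_cst// mule_ge0.
(* The cut inequality for [A i] times 2 h; the 2 comes from counting both orientations of an
   edge. *)
have le3 : \sum_(i < n) k%:E * ((2 * h)%:E * kprod_rect mu (cst_kernel mu) (A i) (~` A i))
    <= \sum_(i < n) ((2 * h)%:E * kprod_rect mu P (A i) (~` A i) + (2 * h * (k * u))%:E).
  apply: lee_sum => i _.
  rewrite kprod_rect_cst// muleCA [X in _ <= _ + X]EFinM -ge0_muleDr; last 2 first.
  - by apply: integral_ge0.
  - by rewrite lee_fin mulr_ge0.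
  by apply: lee_wpmul2l; [rewrite lee_fin mulr_ge0// ltW|exact: cutP].
apply: (le_trans (leeD2r _ le3)).
rewrite big_split/= -edgeG// sumEFin sumr_const card_ord.
apply: (le_trans (leeD2r _ (leeD2r _ le2))).
move: (edge_integral mu P D) => e.
rewrite -EFinM -!addeA -!EFinD leeD2l// lee_fin -mulr_natr; lra.
Qed.
End weak_L1_poincare.

(** * Square-integrable functions and the Dirichlet form *)

Section square_integrable.
Context d (T : measurableType d) (R : realType) (m : {measure set T -> \bar R}).
Hypothesis m1 : m setT = 1.
Variable f : T -> R.
Hypotheses (mf : measurable_fun setT f).
Hypotheses (if2 : m.-integrable setT (fun x => (f x ^+ 2)%:E)).

Lemma integrable_cst_prob (c : R) : m.-integrable setT (fun=> c%:E).
Proof.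
apply/integrableP; split; first exact: measurable_cst.
by rewrite integral_cst_prob//= ltry.
Qed.

(** |f| <= 1 + f^2, and constants are integrable for a measure of mass 1. *)
Lemma integrable_sqrW : m.-integrable setT (EFin \o f).
Proof.
apply: (@le_integrable _ _ _ _ _ measurableT _ (fun x => 1%:E + (f x ^+ 2)%:E)).
- exact/measurable_EFinP.
- move=> x _ /=; rewrite lee_fin [leRHS]ger0_norm ?addr_ge0 ?sqr_ge0//.
  have [f1|/ltW f1] := leP `|f x|%R 1%R.
    by rewrite (le_trans f1)// lerDl sqr_ge0.
  by rewrite -real_normK ?num_real// ler_wpDl// expr2 ler_peMl.
- by apply: integrableD => //; exact: integrable_cst_prob.
Qed.

Lemma integral_sqrB (s : R) :
  \int[m]_y ((s - f y) ^+ 2)%:E =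
  (s ^+ 2 - 2 * (s * (\int[m]_y f y)%R))%:E + \int[m]_y (f y ^+ 2)%:E.
Proof.
have if1 := integrable_sqrW.
have icst := integrable_cst_prob (s ^+ 2).
have ilin : m.-integrable setT (fun y => (2 * s)%:E * (f y)%:E).
  exact: integrableZl.
under eq_integral => y _.
  have -> : ((s - f y) ^+ 2 = s ^+ 2 - 2 * s * f y + f y ^+ 2)%R by ring.
  rewrite EFinD EFinB EFinM; over.
rewrite integralD//; last exact: integrableB.
rewrite integralB// integral_cst_prob// (integralZl measurableT if1).
have -> : \int[m]_y (f y)%:E = (\int[m]_y f y)%R%:E.
  by rewrite /Rintegral fineK//; exact: integrable_fin_num.
by rewrite -EFinM -EFinB mulrA.
Qed.
End square_integrable.

Section dirichlet_form.
Context d (E : measurableType d) (R : realType) (mu : probability E R).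
Variable K : R.-pker E ~> E.
Hypothesis revK : reversible mu K.
Variable f : E -> R.
Hypotheses (mf : measurable_fun setT f).
Hypotheses (if2 : mu.-integrable setT (fun x => (f x ^+ 2)%:E)).

(** K(f^2), of mu-integral mu(f^2) by invariance, hence finite almost everywhere. Where it is
    finite, f is square integrable for [K x] and (s - f)^2 can be expanded under the inner
    integral. *)
Let q x := \int[K x]_y (f y ^+ 2)%:E.

Let mf2 : measurable_fun setT (fun x => (f x ^+ 2)%:E).
Proof. by apply/measurable_EFinP; exact: measurable_funX. Qed.

Let q_ge0 x : 0 <= q x.
Proof. by apply: integral_ge0 => y _; rewrite lee_fin sqr_ge0. Qed.

Let measurable_q : measurable_fun setT q.
Proof.
apply: measurable_fun_integral_kernel => //.
- by move=> U mU; exact: measurable_kernel.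
- by move=> y; rewrite lee_fin sqr_ge0.
Qed.

Let integral_q : \int[mu]_x q x = \int[mu]_x (f x ^+ 2)%:E.
Proof. by apply: invariant_integral => // x; rewrite lee_fin sqr_ge0. Qed.

Let integrable_q : mu.-integrable setT q.
Proof.
apply/integrableP; split => //.
under eq_integral do rewrite gee0_abs//.
by rewrite integral_q; exact: integrable_lty.
Qed.

Let if2K x : q x \is a fin_num -> (K x).-integrable setT (fun y => (f y ^+ 2)%:E).
Proof.
move=> qfin; apply/integrableP; split => //.
under eq_integral do rewrite gee0_abs ?lee_fin ?sqr_ge0//.
by rewrite ltey_eq qfin.
Qed.

Let sqrB x (s : R) : q x \is a fin_num ->
  \int[K x]_y ((s - f y) ^+ 2)%:E = (s ^+ 2 - 2 * (s * kernel_act K f x))%:E + q x.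
Proof.
by move=> qfin; rewrite integral_sqrB//; [exact: prob_kernel|exact: if2K].
Qed.

Let measurable_act : measurable_fun setT (kernel_act K f).
Proof.
apply: (measurableT_comp (fine_measurable _)) => //.
under eq_fun do rewrite integralE.
apply: emeasurable_funB; apply: measurable_fun_integral_kernel => //.
- by move=> U mU; exact: measurable_kernel.
- by apply: measurable_funepos; exact/measurable_EFinP.
- by move=> U mU; exact: measurable_kernel.
- by apply: measurable_funeneg; exact/measurable_EFinP.
Qed.

(** Integrating (f(x) - f(y))^2 >= 0 and (f(x) + f(y))^2 >= 0 in y gives 2 |f Kf| <= f^2 + q
    wherever q is finite; elsewhere the dominating function is infinite. *)
Let integrable_mul_act : mu.-integrable setT (fun x => (f x * kernel_act K f x)%:E).
Proof.
apply: (@le_integrable _ _ _ _ _ measurableT _ (fun x => (f x ^+ 2)%:E + q x)).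
- by apply/measurable_EFinP; exact: measurable_funM.
- move=> x _; rewrite [leRHS]gee0_abs; last first.
    by rewrite adde_ge0// lee_fin sqr_ge0.
  have [qfin|] := boolP (q x \is a fin_num); last first.
    by rewrite ge0_fin_numE// -leNgt leye_eq => /eqP ->; rewrite addey// leey.
  have pos (s : R) : 0 <= \int[K x]_y ((s - f y) ^+ 2)%:E.
    by apply: integral_ge0 => y _; rewrite lee_fin sqr_ge0.
  have := pos (f x); have := pos (- f x)%R; rewrite !sqrB//.
  rewrite -(fineK qfin) -!EFinD !lee_fin sqrrN.
  have : (0 <= fine (q x))%R by rewrite fine_ge0.
  have := sqr_ge0 (f x).
  by rewrite ler_norml => *; apply/andP; split; lra.
- exact: integrableD.
Qed.

(** The inner integral expands to f^2 - 2 f Kf + q, and mu(q) = mu(f^2), so the total is 2 mu(f^2) -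
    2 mu(f Kf). *)
Lemma edge_integral_sqrB :
  edge_integral mu K (fun z => (f z.1 - f z.2) ^+ 2)%R = (2 * dirichlet mu K f)%:E.
Proof.
have Efine (g : E -> R) : mu.-integrable setT (EFin \o g) ->
    \int[mu]_x (g x)%:E = (\int[mu]_x g x)%R%:E.
  by move=> ig; rewrite /Rintegral fineK//; exact: integrable_fin_num.
have imul : mu.-integrable setT (EFin \o (fun x => 2 * (f x * kernel_act K f x))%R).
  rewrite (_ : _ \o _ = fun x => 2%:E * (f x * kernel_act K f x)%:E).
    exact: integrableZl.
  by apply/funext => x; rewrite /= EFinM.
transitivity (\int[mu]_x
    ((f x ^+ 2 - 2 * (f x * kernel_act K f x))%:E + q x)).
  (* The expansion is available only where q is finite, so the integrands agree almost
     everywhere. *)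
  apply: ae_eq_integral => //.
  - apply: (measurable_kernel_integral K (F := fun z => (f z.1 - f z.2) ^+ 2)%R)
      => [|z]; last exact: sqr_ge0.
    by apply: measurable_funX; apply: measurable_funB; exact: measurableT_comp.
  - apply: emeasurable_funD => //; apply/measurable_EFinP.
    apply: measurable_funB; first exact: measurable_funX.
    by apply: measurable_funM => //; exact: measurable_funM.
  - have := integrable_ae measurableT integrable_q.
    by apply: filterS => x /(_ I) qfin _ /=; exact: sqrB.
under eq_integral do rewrite EFinB.
rewrite integralD//; last exact: integrableB.
rewrite integralB// integral_q (Efine _ if2) (Efine _ imul) -EFinB -EFinD.
congr (_%:E); rewrite RintegralZl// /dirichlet /inner_L2.
under [in RHS]eq_Rintegral do rewrite mulrBl -expr2 [X in (_ - X)%R]mulrC.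
by rewrite RintegralB//; ring.
Qed.
End dirichlet_form.

(** * Pointwise inequalities for the signed square s |s| *)

Section signed_square.
Variable R : realFieldType.
Implicit Types s t k : R.

Lemma signed_square_lb s t :
  (2^-1 * (s - t) ^+ 2 <= `|s * `|s| - t * `|t| |)%R.
Proof.
wlog st : s t / (t <= s)%R => [H|].
  have [ts|/ltW st] := leP t s; first exact: H.
  by rewrite -sqrrN opprB distrC; exact: H.
(* For t <= s the right side minus the left is (s - t)(s + 3t)/2 when both are nonnegative, (s +
   t)^2/2 for opposite signs, and (s - t)(-t - 3s)/2 when both are nonpositive. *)
have [s0|/ltW s0] := leP 0%R s; have [t0|/ltW t0] := leP 0%R t.
- rewrite (ger0_norm s0) (ger0_norm t0); apply: le_trans (ler_norm _).
  have : (0 <= (s - t) * (s + 3 * t))%R by apply: mulr_ge0; lra.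
  lra.
- rewrite (ger0_norm s0) (ler0_norm t0); apply: le_trans (ler_norm _).
  have := sqr_ge0 (s + t)%R; lra.
- have -> : s = t by apply/eqP; rewrite eq_le st (le_trans s0).
  by rewrite !subrr normr0 expr0n mulr0.
- rewrite (ler0_norm s0) (ler0_norm t0); apply: le_trans (ler_norm _).
  have : (0 <= (s - t) * (- t - 3 * s))%R by apply: mulr_ge0; lra.
  lra.
Qed.

(** The signed square satisfies the Lipschitz bound |s - t| (|s| + |t|), which a weighted AM-GM
    splits. The weight is such that the last term integrates to (k/2) ||f||^2, half of what the
    Cheeger argument has on the left. *)
Lemma signed_square_ub k s t : (0 < k)%R ->
  (`|s * `|s| - t * `|t| | <= 2 / k * (s - t) ^+ 2 + k / 4 * (s ^+ 2 + t ^+ 2))%R.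
Proof.
move=> k0.
have lip : (`|s * `|s| - t * `|t| | <= `|s - t| * (`|s| + `|t|))%R.
  rewrite ler_norml -[(s - t)%R]opprK normrN opprB.
  have [s0|/ltW s0] := leP 0%R s; have [t0|/ltW t0] := leP 0%R t;
  rewrite ?(ger0_norm s0) ?(ger0_norm t0) ?(ler0_norm s0) ?(ler0_norm t0);
  have [ts|/ltW ts] := leP 0%R (t - s)%R;
  rewrite ?(ger0_norm ts) ?(ler0_norm ts); apply/andP; split; nra.
apply: (le_trans lip); set p := `|s - t|%R; set q := (`|s| + `|t|)%R.
have -> : ((s - t) ^+ 2 = p ^+ 2)%R by rewrite real_normK// num_real.
have q2 : (q ^+ 2 <= 2 * (s ^+ 2 + t ^+ 2))%R.
  rewrite -(real_normK (num_real s)) -(real_normK (num_real t)) /q.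
  by have := sqr_ge0 (`|s| - `|t|)%R; nra.
have amgm : (p * q <= 2 / k * p ^+ 2 + k / 8 * q ^+ 2)%R.
  rewrite -subr_ge0.
  have -> : (2 / k * p ^+ 2 + k / 8 * q ^+ 2 - p * q =
    (4 * p - k * q) ^+ 2 / (8 * k))%R by field; rewrite gt_eqF.
  by rewrite divr_ge0 ?sqr_ge0// mulr_ge0// ltW.
apply: (le_trans amgm); rewrite lerD2l.
by apply: (le_trans (ler_wpM2l _ q2)); [rewrite divr_ge0// ltW|lra].
Qed.
End signed_square.

(** * The weak Poincaré inequality for an essentially bounded function *)

Section bounded_weak_poincare.
Context d (E : measurableType d) (R : realType) (mu : probability E R).
Variable P : R.-pker E ~> E.
Hypothesis revP : reversible mu P.
Variable f : E -> R.
Hypotheses (mf : measurable_fun setT f).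
Hypotheses (if2 : mu.-integrable setT (fun x => (f x ^+ 2)%:E)).

Lemma dirichlet_ge0 : (0 <= dirichlet mu P f)%R.
Proof.
have := edge_integral_sqrB revP mf if2.
have : 0 <= edge_integral mu P (fun z => (f z.1 - f z.2) ^+ 2)%R.
  by apply: edge_integral_ge0 => z; exact: sqr_ge0.
by move=> + eqD; rewrite eqD lee_fin pmulr_rge0.
Qed.

Hypothesis f0 : (\int[mu]_x f x)%R = 0%R.
Variables a b : R.
Hypothesis fab : \forall x \ae mu, (a <= f x <= b)%R.

(** Truncation of f to [a, b]: it agrees with f almost everywhere and has at every point the bounds
    that slicing into levels requires. *)
Let g x := Num.max a (Num.min b (f x)).

Let mg : measurable_fun setT g.
Proof. by apply: measurable_maxr => //; exact: measurable_minr. Qed.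

Let fg : ae_eq mu setT f g.
Proof.
by apply: filterS fab => x /andP[af fb] _; rewrite /g (min_idPr fb) (max_idPr af).
Qed.

Let ab : (a <= b)%R.
Proof.
have muT : 0 < mu setT by rewrite probability_setT.
have [x /andP[]] := @filter_ex _ _ (ae_properfilter_algebraOfSetsType muT) _ fab.
exact: le_trans.
Qed.

Let g_bounds x : (a <= g x <= b)%R.
Proof. by rewrite le_max lexx ge_max ab ge_min lexx. Qed.

(** Truncation is 1-Lipschitz. This lets the energy of f itself bound the edge integral of g. *)
Let g_lipschitz x y : ((g x - g y) ^+ 2 <= (f x - f y) ^+ 2)%R.
Proof.
rewrite -(real_normK (num_real (g x - g y)%R)).
rewrite -(real_normK (num_real (f x - f y)%R)) ler_sqr ?nnegrE//.
rewrite /g /Num.max /Num.min.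
have := ler_norm (f x - f y)%R; have := ler_norm (- (f x - f y))%R.
rewrite normrN => h1 h2; rewrite ler_norml.
by case: (ltP b (f x)) => ?; case: (ltP b (f y)) => ?;
  repeat (case: ltP => ?); apply/andP; split; lra.
Qed.

Let ig2 : mu.-integrable setT (fun x => (g x ^+ 2)%:E).
Proof.
apply: (@measurable_bounded_integrable _ _ _ mu (fun x => g x ^+ 2)%R) => //.
- by rewrite -ge0_fin_numE// fin_num_measure.
- exact: measurable_funX.
- exists ((`|a| + `|b|) ^+ 2)%R; split; first exact: num_real.
  move=> M aM x _ /=; apply: le_trans (ltW aM).
  rewrite ger0_norm ?sqr_ge0// -(real_normK (num_real (g x))).
  rewrite ler_sqr ?nnegrE ?addr_ge0//.
  have /andP[? ?] := g_bounds x.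
  have := ler_norm (- a)%R; have := ler_norm b; rewrite normrN ler_norml.
  have := normr_ge0 a; have := normr_ge0 b.
  by move=> *; apply/andP; split; lra.
Qed.

Let ig : mu.-integrable setT (EFin \o g).
Proof. by apply: integrable_sqrW => //; exact: probability_setT. Qed.

Let g0 : (\int[mu]_x g x)%R = 0%R.
Proof.
rewrite -f0; congr fine; apply/esym/ae_eq_integral => //.
- exact/measurable_EFinP.
- exact/measurable_EFinP.
- by apply: filterS fg => x /(_ I) ->.
Qed.

Let intg2 : \int[mu]_x (g x ^+ 2)%:E = (\int[mu]_x f x ^+ 2)%R%:E.
Proof.
transitivity (\int[mu]_x (f x ^+ 2)%:E); last first.
  by rewrite /Rintegral fineK//; exact: integrable_fin_num.
apply: ae_eq_integral => //.
- exact: measurable_int ig2.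
- exact: measurable_int if2.
- by apply: filterS fg => x /(_ I) ->.
Qed.

(** The mean of g is 0 and lies between the bounds of g. *)
Let ab0 : (a <= 0 <= b)%R.
Proof.
have icst c : mu.-integrable setT (EFin \o (fun=> c)).
  by apply: integrable_cst_prob; exact: probability_setT.
have Rcst c : (\int[mu]_x c = c)%R.
  by rewrite /Rintegral integral_cst_prob//; exact: probability_setT.
rewrite -g0 -{1}(Rcst a) -{1}(Rcst b); apply/andP; split;
  by apply: le_Rintegral => // x _; have /andP[] := g_bounds x.
Qed.

(** The shift by a^2 makes the signed square nonnegative without changing its differences. The
    values stay below a^2 + b^2, which is at most (b - a)^2 because a b <= 0. *)
Let phi x : R := (g x * `|g x| + a ^+ 2)%R.

Let mphi : measurable_fun setT phi.
Proof.
by apply: measurable_funD => //; apply: measurable_funM => //; exact: measurableT_comp.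
Qed.

Let phi_bounds x : (0 <= phi x <= (b - a) ^+ 2)%R.
Proof.
have /andP[a0 b0] := ab0; have /andP[ag gb] := g_bounds x; rewrite /phi.
have [gx0|/ltW gx0] := leP 0%R (g x).
  rewrite ger0_norm// addr_ge0 ?sqr_ge0 ?mulr_ge0//=.
  have : (g x * g x <= b * b)%R by rewrite ler_pM.
  have : (0 <= (- a) * b)%R by rewrite mulr_ge0// oppr_ge0.
  lra.
rewrite ler0_norm//.
have : (0 <= (g x - a) * (- g x - a))%R by apply: mulr_ge0; lra.
have : (0 <= (- a) * b)%R by rewrite mulr_ge0// oppr_ge0.
have : (0 <= g x * g x)%R by rewrite -expr2 sqr_ge0.
have : (0 <= b * b)%R by rewrite -expr2 sqr_ge0.
by move=> *; apply/andP; split; lra.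
Qed.

Let phiB x y : (`|phi x - phi y| = `|g x * `|g x| - g y * `|g y| |)%R.
Proof. by congr `|_|%R; rewrite /phi; ring. Qed.


Variables (k u : R).
Hypotheses (k0 : (0 < k)%R) (u0 : (0 < u)%R).
Hypothesis cutP : forall A, measurable A ->
  k%:E * (mu A * mu (~` A)) <= kprod_rect mu P A (~` A) + (k * u)%:E.

Let I := (\int[mu]_x f x ^+ 2)%R.

Let msqrB (h : E -> R) : measurable_fun setT h ->
  measurable_fun setT (fun z : E * E => (h z.1 - h z.2) ^+ 2)%R.
Proof.
move=> mh; apply: measurable_funX.
by apply: measurable_funB; exact: measurableT_comp.
Qed.

Let mphiB : measurable_fun setT (fun z : E * E => `|phi z.1 - phi z.2|)%R.
Proof.
apply: measurableT_comp => //.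
by apply: measurable_funB; exact: measurableT_comp.
Qed.

(** For a centred g, half the mean of (g(x) - g(y))^2 over independent x, y is the variance ||g||^2
    = ||f||^2; it is computed as the Dirichlet form of the constant kernel, which sends g to 0. *)
Let independent_lb :
  I%:E <= edge_integral mu (cst_kernel mu) (fun z => `|phi z.1 - phi z.2|)%R.
Proof.
have -> : I%:E = edge_integral mu (cst_kernel mu)
    (fun z => 2^-1 * (g z.1 - g z.2) ^+ 2)%R.
  rewrite edge_integralZl//; [|exact: msqrB|by move=> z; exact: sqr_ge0].
  rewrite edge_integral_sqrB//; last exact: reversible_cst.
  rewrite -EFinM mulrA mulVf// mul1r /dirichlet /inner_L2 /kernel_act.
  under [in RHS]eq_Rintegral.
    move=> x _.
    have -> : (\int[cst_kernel mu x]_y g y = 0)%R by exact: g0.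
    rewrite subr0 -expr2; over.
  by rewrite /Rintegral intg2.
apply: le_edge_integral => //.
- by apply: measurable_funM => //; exact: msqrB.
- by move=> z; rewrite mulr_ge0// sqr_ge0.
- by move=> z; rewrite phiB; exact: signed_square_lb.
Qed.

(** The squared difference contributes (2/k) times 2 E(P, f). Both marginals of mu (x) P are mu, so
    the remaining term contributes (k/4) times 2 ||f||^2. *)
Let edge_ub : edge_integral mu P (fun z => `|phi z.1 - phi z.2|)%R <=
  (4 / k * dirichlet mu P f + k / 2 * I)%:E.
Proof.
have mg2 (h : E * E -> E) : measurable_fun setT h ->
    measurable_fun setT (fun z => g (h z) ^+ 2)%R.
  by move=> mh; apply: measurable_funX; exact: measurableT_comp.
have k4 : (0 <= k / 4)%R by rewrite divr_ge0// ltW.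
have k2 : (0 <= 2 / k)%R by rewrite divr_ge0// ltW.
apply: (@le_trans _ _ (edge_integral mu P (fun z =>
    (2 / k * (f z.1 - f z.2) ^+ 2) +
    (k / 4 * (g z.1 ^+ 2 + g z.2 ^+ 2)))%R)).
  apply: le_edge_integral => //.
  - apply: measurable_funD; apply: measurable_funM => //; first exact: msqrB.
    by apply: measurable_funD; exact: mg2.
  - move=> z; rewrite phiB (le_trans (signed_square_ub _ _ k0))// lerD2r.
    by rewrite ler_wpM2l.
rewrite edge_integralD; last 4 first.
- by apply: measurable_funM => //; exact: msqrB.
- by move=> z; rewrite mulr_ge0// sqr_ge0.
- apply: measurable_funM => //.
  by apply: measurable_funD; exact: mg2.
- by move=> z; rewrite mulr_ge0// addr_ge0// sqr_ge0.
rewrite edge_integralZl//; last 2 first.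
- by apply: measurable_funD; exact: mg2.
- by move=> z; rewrite addr_ge0// sqr_ge0.
rewrite edge_integralZl//; [|exact: msqrB|by move=> z; exact: sqr_ge0].
rewrite edge_integral_sqrB//.
rewrite edge_integralD; last 4 first.
- exact: mg2.
- by move=> z; exact: sqr_ge0.
- exact: mg2.
- by move=> z; exact: sqr_ge0.
rewrite (edge_integral_fst mu P (fun x => g x ^+ 2)%R).
rewrite (@edge_integral_snd _ _ _ mu P (fun x => g x ^+ 2)%R)//; last 2 first.
- exact: measurable_funX.
- by move=> x; exact: sqr_ge0.
rewrite intg2 -/I -(EFinD I I) -!EFinM -EFinD lee_fin; lra.
Qed.

Lemma weak_poincare_of_cut :
  (\int[mu]_x f x ^+ 2 <=
   16 / k ^+ 2 * dirichlet mu P f + 16 * u * (b - a) ^+ 2)%R.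
Proof.
have D0 := dirichlet_ge0.
set D := dirichlet mu P f in D0 *; rewrite -/I.
have u_ge0 := ltW u0; have k_ge0 := ltW k0.
have rhs0 : (0 <= 16 / k ^+ 2 * D + 16 * u * (b - a) ^+ 2)%R.
  apply: addr_ge0; apply: mulr_ge0 => //; last exact: sqr_ge0.
    by rewrite divr_ge0 ?ler0n ?sqr_ge0.
  by rewrite mulr_ge0 ?ler0n.
(* If a = b then both are 0 and f vanishes almost everywhere. Otherwise (b - a)^2 > 0, which gives a
   positive mesh below. *)
have [ba0|ba0] := eqVneq a b.
  suff -> : I = 0%R by [].
  have /andP[a0 b0] := ab0.
  have a00 : a = 0%R by apply/eqP; rewrite eq_le a0 ba0.
  have gx0 x : g x = 0%R.
    by apply/eqP; rewrite eq_le; have := g_bounds x; rewrite -ba0 a00 andbC.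
  apply/EFin_inj; rewrite -intg2; apply: integral0_eq => x _.
  by rewrite gx0 expr0n.
pose c := ((b - a) ^+ 2)%R.
have c0 : (0 < c)%R by rewrite exprn_even_gt0//= subr_eq0 eq_sym.
(* Enough levels for the rounding cost (k + 1) c / n to be at most k u c. *)
pose n := (Num.truncn ((k + 1) / (k * u))).+1.
have n0 : (0 < n%:R :> R)%R by rewrite ltr0n.
have kn : (k + 1 <= k * u * n%:R)%R.
  by rewrite mulrC -ler_pdivrMr ?mulr_gt0// ltW// truncnS_gt.
have h0 : (0 < c / n%:R)%R by rewrite divr_gt0.
have hn : (c / n%:R * n%:R = c)%R by rewrite divfK// gt_eqF.
have := @weak_L1_poincare _ _ _ mu P revP k u k_ge0 u_ge0 cutP
  phi (c / n%:R)%R n mphi h0.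
rewrite hn => /(_ phi_bounds) wL1.
have : k%:E * I%:E <= (4 / k * D + k / 2 * I)%:E +
    (2 * k * u * c + (k + 1) * (c / n%:R))%:E.
  apply: (@le_trans _ _ _ _ _ (le_trans _ wL1)).
    by apply: lee_wpmul2l independent_lb; rewrite lee_fin.
  exact: leeD2r edge_ub.
rewrite -EFinM -EFinD lee_fin => main.
have err : ((k + 1) * (c / n%:R) <= k * u * c)%R.
  by rewrite mulrCA mulrC ler_wpM2r ?(ltW c0)// ler_pdivrMr.
(* Half of k ||f||^2 is absorbed on the left; 2 k u c from the levels and k u c from rounding make 3
   k u c. Dividing by k leaves the constants 8 and 6, both below 16. *)
have : (k * I <= 2 * (4 / k * D + 3 * (k * u * c)))%R by lra.
rewrite -ler_pdivlMl// => /le_trans; apply.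
have -> : (k^-1 * (2 * (4 / k * D + 3 * (k * u * c))) =
    8 / k ^+ 2 * D + 6 * u * c)%R by field; rewrite gt_eqF.
have : (0 <= D / k ^+ 2)%R by rewrite divr_ge0// sqr_ge0.
have : (0 <= u * c)%R by rewrite mulr_ge0// ltW.
rewrite -/c -!mulrA [(k ^- 2 * D)%R]mulrC; lra.
Qed.
End bounded_weak_poincare.

(** * The L^2 norm and the essential oscillation *)

Section L2_norm.
Context d (T : measurableType d) (R : realType) (m : {measure set T -> \bar R}).
Implicit Type f : T -> R.

Lemma Lnorm2_sqr f : 'N[m]_2%:E [EFin \o f] ^+ 2 = \int[m]_x (f x ^+ 2)%:E.
Proof.
have -> : \int[m]_x (f x ^+ 2)%:E = 'N[m]_2%:E [EFin \o f] `^ 2.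
  rewrite poweR_Lnorm//; apply: eq_integral => x _ /=.
  by rewrite powR_mulrn// real_normK// num_real.
have := Lnorm_ge0 m 2%:E (EFin \o f).
case: ('N[m]_2%:E[_]) => [x x0| _|//].
  by rewrite poweR_EFin powR_mulrn.
by rewrite poweRyr.
Qed.

Lemma Lfun2_of_integrable_sqr f : measurable_fun setT f ->
  m.-integrable setT (fun x => (f x ^+ 2)%:E) -> f \in Lfun m 2%:E.
Proof.
move=> mf if2; rewrite inE; apply/andP; split; rewrite inE//=.
rewrite /finite_norm ltNge leye_eq; apply/eqP => foo.
by have := integrable_lty measurableT if2; rewrite -Lnorm2_sqr foo.
Qed.
End L2_norm.

Section osc.
Context d (E : measurableType d) (R : realType) (mu : probability E R).
Implicit Type f : E -> R.

Lemma ess_inf_sup_ae f :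
  \forall x \ae mu, ess_inf mu (EFin \o f) <= (f x)%:E <= ess_sup mu (EFin \o f).
Proof.
apply: filterS2 (ess_inf_le mu (EFin \o f)) (ess_sup_ge mu (EFin \o f)).
by move=> x /= -> ->.
Qed.

Lemma ess_inf_le_ess_sup f : ess_inf mu (EFin \o f) <= ess_sup mu (EFin \o f).
Proof.
have muT : 0 < mu setT by rewrite probability_setT.
have [x /andP[]] :=
  @filter_ex _ _ (ae_properfilter_algebraOfSetsType muT) _ (ess_inf_sup_ae f).
exact: le_trans.
Qed.

Lemma osc_bounded f (a b : R) : (forall x, (a <= f x <= b)%R) ->
  osc mu f ^+ 2 <= ((b - a) ^+ 2)%:E.
Proof.
move=> fab; have := ess_inf_le_ess_sup f; rewrite /osc.
have : ess_sup mu (EFin \o f) <= b%:E.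
  by apply/ess_supP/aeW => x /=; rewrite lee_fin; have /andP[] := fab x.
have : a%:E <= ess_inf mu (EFin \o f).
  by apply/ess_infP/aeW => x /=; rewrite lee_fin; have /andP[] := fab x.
case: (ess_inf _ _) => [i| |]//; case: (ess_sup _ _) => [s| |]//.
rewrite !lee_fin => ai sb is_.
by rewrite -expr2 ler_sqr ?nnegrE; lra.
Qed.

(** The witnesses are the essential infimum and supremum, both real when their difference is
    finite. *)
Lemma osc_fin_num f : osc mu f \is a fin_num ->
  exists a b : R, [/\ \forall x \ae mu, (a <= f x <= b)%R
    & osc mu f ^+ 2 = ((b - a) ^+ 2)%:E].
Proof.
have := ess_inf_sup_ae f; rewrite /osc fin_numB => + /andP[].
case: (ess_sup _ _) => [b| |]//; case: (ess_inf _ _) => [a| |]// + _ _.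
by move=> fab; exists a, b; split.
Qed.
End osc.

(** * Weak conductance and the cut inequality *)

Section conductance.
Context d (E : measurableType d) (R : realType) (mu : probability E R).
Variable P : R.-pker E ~> E.
Notation kappa := (weak_conductance mu P).
Implicit Types (A : set E) (u k : R).

Lemma probability_cut A : measurable A -> exists2 p : R, (0 <= p <= 1)%R &
  [/\ mu A = p%:E, mu (~` A) = (1 - p)%:E
    & (mu \x mu) (A `*` ~` A) = (p * (1 - p))%:E].
Proof.
move=> mA; have mAC : measurable (~` A) by exact: measurableC.
exists (fine (mu A)); rewrite ?fine_ge0//=.
  by rewrite -lee_fin fineK ?fin_num_measure// probability_le1.
have muA : mu A = (fine (mu A))%:E by rewrite fineK// fin_num_measure.
have muAC : mu (~` A) = (1 - fine (mu A))%:E.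
  by rewrite probability_setC// EFinB -muA.
split=> //; transitivity (mu A * mu (~` A)); first exact: product_measure1E.
by rewrite muAC {1}muA.
Qed.

(** p (1 - p) <= 1/4, so no set is admissible and the infimum is over the empty set. *)
Lemma weak_conductance_pinfty u : (1 / 4 <= u)%R -> kappa u = +oo.
Proof.
move=> u4; rewrite /weak_conductance [X in ereal_inf X](_ : _ = set0) ?ereal_inf0//.
rewrite -subset0 => x [A [mA +] _].
have [p _ [_ _ ->]] := probability_cut mA; rewrite lte_fin.
by have := sqr_ge0 (p - 2^-1)%R; lra.
Qed.

Lemma weak_conductance_mono u v : (u <= v)%R -> kappa u <= kappa v.
Proof.
move=> uv; apply: ereal_inf_le_tmp => _ [A [mA vA] <-].
by exists A => //; split=> //; apply: le_lt_trans vA; rewrite lee_fin.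
Qed.

(** If the cut has product mass at most u, the error k u alone suffices; otherwise A competes in the
    infimum. The bound thus covers every A, as slicing demands, and a real k below [kappa u] also
    handles an infinite conductance. *)
Lemma cut_of_weak_conductance u k A : (0 <= u)%R -> (0 <= k)%R ->
  k%:E <= kappa u -> measurable A ->
  k%:E * (mu A * mu (~` A)) <= kprod_rect mu P A (~` A) + (k * u)%:E.
Proof.
move=> u0 k0 ku mA.
have kp0 : 0 <= kprod_rect mu P A (~` A) by apply: integral_ge0.
have [p _ [-> -> muA]] := probability_cut mA.
rewrite -!EFinM; have [pu|pu] := leP (p * (1 - p))%R u.
  by rewrite (@le_trans _ _ (k * u)%:E) ?leeDr// lee_fin ler_wpM2l.
have kA : k%:E <= kprod_rect mu P A (~` A) / (p * (1 - p))%:E.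
  apply: (le_trans ku); rewrite -muA; apply: ge_ereal_inf.
  by eexists; [exists A => //; rewrite /= muA lte_fin|exact: lexx].
have p0 : (0 < p * (1 - p))%R by exact: le_lt_trans pu.
move: kA; rewrite inver gt_eqF// lee_pdivlMr// -EFinM => /le_trans; apply.
by rewrite leeDl// lee_fin mulr_ge0.
Qed.
End conductance.

(** * From weak conductance to the weak Poincaré inequality *)

Section conductance_to_WPI.
Context d (E : measurableType d) (R : realType) (mu : probability E R).
Variable P : R.-pker E ~> E.
Hypothesis revP : reversible mu P.
Notation kappa := (weak_conductance mu P).
Hypothesis kappa_gt0 : forall u : R, (0 < u < 1 / 4)%R -> 0 < kappa u.

Let kappa0 u : (0 < u)%R -> 0 < kappa u.
Proof.
move=> u0; have [u4|u4] := ltP u (1 / 4)%R; first by rewrite kappa_gt0// u0.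
by rewrite weak_conductance_pinfty// lt0y.
Qed.

Let rate_fin r : (0 < r)%R -> 0 <= 16%:E / kappa (r / 16)%R ^+ 2 < +oo.
Proof.
move=> r0; have /kappa0 : (0 < r / 16)%R by rewrite divr_gt0.
case: (kappa _) => [x| |//]; last by rewrite expe2 mulyy invey mule0 lexx ltry.
rewrite lte_fin => x0; rewrite -EFin_expe inver gt_eqF ?exprn_gt0// -EFinM.
by rewrite lee_fin ltry mulr_ge0 ?invr_ge0 ?sqr_ge0.
Qed.

Let rate_mono r s : (0 < r)%R -> (r <= s)%R ->
  16%:E / kappa (s / 16)%R ^+ 2 <= 16%:E / kappa (r / 16)%R ^+ 2.
Proof.
move=> r0 rs; have s0 : (0 < s)%R by exact: lt_le_trans rs.
have : kappa (r / 16)%R <= kappa (s / 16)%R.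
  by apply: weak_conductance_mono; rewrite ler_pM2r.
have /andP[+ _] := rate_fin r0.
have : 0 < kappa (r / 16)%R by apply: kappa0; rewrite divr_gt0.
case: (kappa (s / 16)%R) => [y| |]; case: (kappa (r / 16)%R) => [x| |]//.
- rewrite lte_fin => x0 _; rewrite lee_fin => xy.
  have y0 : (0 < y)%R by exact: lt_le_trans xy.
  rewrite -!EFin_expe !inver !gt_eqF ?exprn_gt0// -!EFinM lee_fin.
  by rewrite ler_wpM2l// lef_pV2 ?posrE ?exprn_gt0// ler_sqr ?nnegrE// ltW.
- by move=> _ rate0 _; apply: le_trans rate0; rewrite expe2 mulyy invey mule0.
Qed.

Lemma weak_conductance_WPI :
  WPI mu P (fun f => osc mu f ^+ 2) (fun r => 16%:E / kappa (r / 16)%R ^+ 2).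
Proof.
split; [exact: rate_fin|exact: rate_mono|move=> r f r0 [Lf f0]].
have mf : measurable_fun setT f by move: Lf; rewrite inE => /andP[]; rewrite inE.
have if2 : mu.-integrable setT (fun x => (f x ^+ 2)%:E).
  exact: Lfun2_integrable_sqr.
rewrite Lnorm2_sqr.
(* With infinite oscillation the right side is infinite, since r > 0 and the rate is finite. *)
have [oscfin|oscoo] := boolP (osc mu f \is a fin_num); last first.
  have -> : osc mu f ^+ 2 = +oo by case: (osc mu f) oscoo.
  rewrite gt0_muley ?lte_fin// addey ?leey//.
  have /andP[] := rate_fin r0; case: (16%:E / _) => // x _ _.
have [a [b [fab ->]]] := osc_fin_num oscfin.
have -> : \int[mu]_x (f x ^+ 2)%:E = (\int[mu]_x f x ^+ 2)%R%:E.
  by rewrite /Rintegral fineK//; exact: integrable_fin_num.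
have u0 : (0 < r / 16)%R by rewrite divr_gt0.
have bound (k : R) : (0 < k)%R -> k%:E <= kappa (r / 16)%R ->
    (\int[mu]_x f x ^+ 2 <= 16 / k ^+ 2 * dirichlet mu P f + r * (b - a) ^+ 2)%R.
  move=> k0 kk.
  have -> : r = (16 * (r / 16))%R by rewrite mulrC divfK.
  apply: weak_poincare_of_cut => // A mA.
  by apply: cut_of_weak_conductance => //; exact: ltW.
move: (kappa0 u0) bound; case: (kappa _) => [x| |//].
- rewrite lte_fin => x0 /(_ x x0 (lexx _)) Hx.
  by rewrite -EFin_expe inver gt_eqF ?exprn_gt0// -!EFinM -EFinD lee_fin.
(* For infinite conductance the rate is 0 and [bound] holds for every k > 0. The k below brings 16
   E(P, f) / k^2 under an arbitrary e > 0: as k >= 1, e k^2 >= e k = e + 16 E(P, f). *)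
- move=> _ bound; rewrite expe2 mulyy invey mule0 mul0e add0e -EFinM lee_fin.
  apply/ler_addgt0Pr => e e0.
  have D0 : (0 <= dirichlet mu P f)%R by exact: dirichlet_ge0.
  pose k := (1 + 16 * dirichlet mu P f / e)%R.
  have k1 : (1 <= k)%R by rewrite lerDl divr_ge0 ?mulr_ge0// ltW.
  have k0 : (0 < k)%R by exact: lt_le_trans k1.
  have := bound k k0 (leey _) => /le_trans; apply.
  rewrite addrC lerD2l mulrAC ler_pdivrMr ?exprn_gt0//.
  apply: (@le_trans _ _ (e * k)%R); last first.
    by rewrite ler_wpM2l ?(ltW e0)// expr2 ler_peMl// ltW.
  have -> : (e * k = e + 16 * dirichlet mu P f)%R.
    by rewrite /k; field; rewrite gt_eqF.
  by rewrite lerDr ltW.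
Qed.
End conductance_to_WPI.

(** * From the weak Poincaré inequality to weak conductance *)

Section WPI_to_conductance.
Context d (E : measurableType d) (R : realType) (mu : probability E R).
Variable P : R.-pker E ~> E.
Hypothesis revP : reversible mu P.
Notation kappa := (weak_conductance mu P).
Variable alpha : R -> \bar R.
Hypothesis wpi : WPI mu P (fun f => osc mu f ^+ 2) alpha.

Lemma WPI_cut (r : R) (A : set E) : (0 < r)%R -> measurable A ->
  (mu \x mu) (A `*` ~` A) <= alpha r * kprod_rect mu P A (~` A) + r%:E.
Proof.
move=> r0 mA; have [p /andP[p0 p1] [muA _ ->]] := probability_cut mu mA.
have mu1 := probability_setT mu.
have m1A : measurable_fun setT (\1_A : E -> R) by exact: measurable_indic.
have i1A : mu.-integrable setT (EFin \o \1_A) by exact: integrable_indic.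
have indic2 x : (\1_A x ^+ 2 = \1_A x :> R)%R.
  by rewrite indicE; case: (_ \in _); rewrite ?expr1n ?expr0n.
have i1A2 : mu.-integrable setT (fun x => ((\1_A x : R) ^+ 2)%:E).
  by apply: eq_integrable i1A => // x _ /=; rewrite indic2.
have int1A : (\int[mu]_x \1_A x)%R = p.
  by rewrite /Rintegral integral_indic// setIT; exact: (congr1 fine muA).
pose f x : R := (p - \1_A x)%R.
have mf : measurable_fun setT f by exact: measurable_funB.
have f2 : \int[mu]_x (f x ^+ 2)%:E = (p * (1 - p))%:E.
  rewrite integral_sqrB// int1A; under eq_integral do rewrite indic2.
  rewrite integral_indic// setIT [X in _ + X](muA : _ = p%:E) -EFinD.
  by congr (_%:E); ring.
have if2 : mu.-integrable setT (fun x => (f x ^+ 2)%:E).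
  apply/integrableP; split.
    by apply/measurable_EFinP; exact: measurable_funX.
  under eq_integral do rewrite gee0_abs ?lee_fin ?sqr_ge0//.
  by rewrite f2 ltry.
have f0 : L2_0 mu f.
  split; first exact: Lfun2_of_integrable_sqr.
  rewrite RintegralB//; last exact: integrable_cst_prob.
  by rewrite int1A /Rintegral integral_cst_prob// subrr.
(* (f(x) - f(y))^2 = |1_A(x) - 1_A(y)|, so the two edge integrals coincide, each carrying a factor 2
   that is then cancelled. *)
have D : (dirichlet mu P f)%:E = kprod_rect mu P A (~` A).
  have : 2%:E * (dirichlet mu P f)%:E = 2%:E * kprod_rect mu P A (~` A).
    rewrite -EFinM -edge_integral_sqrB// -edge_integral_cut//.
    congr edge_integral; apply/funext => -[x y] /=; rewrite /f !indicE.
    by do 2 case: (_ \in _); rewrite /= ?(subrr, subr0, sub0r, normrN, normr0,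
      normr1, expr0n)//; ring.
  have half (x : \bar R) : 2^-1%:E * (2%:E * x) = x.
    by rewrite muleA -EFinM mulVf ?mul1e// gt_eqF.
  by move=> eqD; rewrite -[LHS]half eqD half.
have [_ _ /(_ r f r0 f0)] := wpi.
rewrite Lnorm2_sqr f2 D => /le_trans; apply; rewrite leeD2l//.
rewrite -[leRHS]mule1 lee_wpmul2l ?lee_fin ?(ltW r0)//.
apply: (le_trans (@osc_bounded _ _ _ mu f (p - 1)%R p _)).
  move=> x; rewrite /f indicE.
  by case: (_ \in _); apply/andP; split => /=; lra.
by rewrite lee_fin (_ : p - (p - 1) = 1)%R ?expr1n//; ring.
Qed.

(** For a cut of product mass m > u r and edge mass q, the test inequality gives alpha(r) q >= m - r
    >= m (1 - 1/u), that is 1 / alpha(r) <= (q / m) u / (u - 1). *)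
Lemma WPI_weak_conductance (r u : R) : (0 < r)%R -> (1 < u)%R ->
  (alpha r)^-1 <= kappa (u * r)%R * (u / (u - 1))%:E.
Proof.
move=> r0 u1; have u0 : (0 < u)%R by exact: lt_trans u1.
have s0 : (0 < u / (u - 1))%R by rewrite divr_gt0// subr_gt0.
rewrite -lee_pdivrMr//; apply: le_ereal_inf_tmp => _ [A [mA Acut] <-]; move: Acut.
have := WPI_cut r0 mA; have [p _ [_ _ ->]] := probability_cut mu mA.
have [alpha_fin _ _] := wpi.
have : kprod_rect mu P A (~` A) \is a fin_num.
  rewrite ge0_fin_numE; last by apply: integral_ge0.
  apply: (@le_lt_trans _ _ (\int[mu]_x (1 : \bar R))); last first.
    by rewrite integral_cst_prob ?ltry//; exact: probability_setT.
  rewrite /kprod_rect integral_mkcond; apply: ge0_le_integral => //.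
  - by move=> x _; apply: erestrict_ge0.
  - apply/(measurable_restrictT _ mA); apply: measurable_funTS.
    exact/measurable_kernel/measurableC.
  - move=> x _; rewrite patchE; case: ifPn => // _.
    have <- : P x setT = 1 by exact: prob_kernel.
    apply: le_measure; rewrite ?inE//.
    exact: measurableC.
have : 0 <= kprod_rect mu P A (~` A) by apply: integral_ge0.
case: (kprod_rect _ _ _ _) => [q| |]//; rewrite lee_fin => q0 _.
have := alpha_fin r r0; case: (alpha r) => [al|/andP[_]|//]; last by rewrite ltxx.
rewrite lee_fin => /andP[al0 _].
rewrite -EFinM -EFinD lee_fin lte_fin => cut ur.
set m := (p * (1 - p))%R in cut ur *.
have m0 : (0 < m)%R by apply: lt_trans ur; exact: mulr_gt0.
have rm : (r < m / u)%R by rewrite ltr_pdivlMr// mulrC.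
have mum : (m / u < m)%R by rewrite ltr_pdivrMr// ltr_pMr.
(* If alpha(r) were 0, the cut would have mass m <= r, against r < m / u < m. So 1/0 cannot occur
   once an admissible set exists. *)
have al_gt0 : (0 < al)%R.
  rewrite lt_neqAle al0 andbT; apply: contraTneq cut => <-.
  by rewrite mul0r add0r -ltNge (lt_trans rm).
rewrite !inver !gt_eqF// -!EFinM lee_fin ler_pdivlMr// mulrAC.
rewrite ler_pdivrMr// ler_pdivrMl// mulrA.
have -> : m = ((m - m / u) * (u / (u - 1)))%R.
  by field; rewrite !gt_eqF// subr_gt0.
by rewrite ler_wpM2r ?(ltW s0)//; lra.
Qed.
End WPI_to_conductance.

Theorem theorem38 (d : measure_display) (E : measurableType d) (R : realType)
    (mu : probability E R) (P : R.-pker E ~> E)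
    (mdiag : measurable (diagonal : set (E * E)))
    (revP : reversible mu P) :
  ((forall u : R, (0 < u < 1 / 4)%R -> 0 < weak_conductance mu P u) ->
     WPI mu P (fun f => osc mu f ^+ 2)
       (fun r => 16%:E / weak_conductance mu P (r / 16)%R ^+ 2)) /\
  (forall alpha : R -> \bar R,
     WPI mu P (fun f => osc mu f ^+ 2) alpha ->
     forall r : R, (0 < r)%R ->
       (alpha r)^-1
         <= ereal_inf [set weak_conductance mu P (u * r)%R * (u / (u - 1))%:E |
              u in [set u : R | (1 < u)%R]]
       /\ ereal_inf [set weak_conductance mu P (u * r)%R * (u / (u - 1))%:E |
              u in [set u : R | (1 < u)%R]]
         <= 2%:E * weak_conductance mu P (2 * r)%R).
Proof.
split; first exact: weak_conductance_WPI.
move=> alpha wpi r r0; split.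
  apply: le_ereal_inf_tmp => _ [u /= u1 <-].
  exact: WPI_weak_conductance wpi _ _ r0 u1.
(* The choice u = 2, for which u / (u - 1) = 2. *)
apply: ge_ereal_inf; exists (weak_conductance mu P (2 * r)%R * (2 / (2 - 1))%:E).
  by exists 2%R => //=; rewrite ltr1n.
by rewrite muleC (_ : 2 / (2 - 1) = 2 :> R)%R//; field.
Qed.
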